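(* Let $(X,d)$ be a (not necessarily compact) metric space. (1) Let $f\colon X\to X$ be a homeomorphism. Then $(X,f)$ has $\mathcal{T}_0$-inverse shadowing if and only if for any $\varepsilon>0$ there exists $\delta>0$ such that for any $x\in X$ there exists $y\in X$ such that for any $\delta$-method $\varphi\in\mathcal{T}_0(f,\delta)$ and any $k\in\mathbb{Z}$, $d(f^k(x),\varphi(y)_k)<\varepsilon$. (2) Let $f\colon X\to X$ be a continuous map. Then $(X,f)$ has positive $\mathcal{T}_0$-inverse shadowing if and only if for any $\varepsilon>0$ there exists $\delta>0$ such that for any $x\in X$ there exists $y\in X$ such that for any positive $\delta$-method $\varphi\in\mathcal{T}_0(f,\delta)$ and any $k\in\omega$, $d(f^k(x),\varphi(y)_k)<\varepsilon$.
   Context: $\omega=\{0,1,2,\dots\}$. For $\delta>0$ and a homeomorphism $f\colon X\to X$, a $\delta$-pseudo-orbit is a bi-infinite sequence $(x_k)_{k\in\mathbb{Z}}$ in $X$ with $d(f(x_k),x_{k+1})<\delta$ for all $k\in\mathbb{Z}$; for a continuous $f\colon X\to X$, a positive $\delta$-pseudo-orbit is a sequence $(x_k)_{k\in\omega}$ in $X$ with $d(f(x_k),x_{k+1})<\delta$ for all $k\in\omega$. Let $\Phi_f(\delta)\subseteq X^{\mathbb{Z}}$ (resp. $\Phi_f^+(\delta)\subseteq X^\omega$) be the set of all $\delta$-pseudo-orbits (resp. positive $\delta$-pseudo-orbits). A $\delta$-method (resp. positive $\delta$-method) for $f$ is a map $\varphi\colon X\to\Phi_f(\delta)$ (resp.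 $\varphi\colon X\to\Phi_f^+(\delta)$), not necessarily continuous, such that $\varphi(x)_0=x$ for every $x\in X$, where $\varphi(x)_k$ denotes the $k$-th term of $\varphi(x)$. $\mathcal{T}_0(f,\delta)$ is the set of all $\delta$-methods (resp. all positive $\delta$-methods, when the positive version is considered). A homeomorphism (resp. continuous map) $f$ has $\mathcal{T}_0$-inverse shadowing (resp. positive $\mathcal{T}_0$-inverse shadowing) if for any $\varepsilon>0$ there exists $\delta>0$ such that for any $x\in X$ and any $\delta$-method (resp. positive $\delta$-method) $\varphi\in\mathcal{T}_0(f,\delta)$ there exists $y\in X$ such that $d(\varphi(y)_k,f^k(x))<\varepsilon$ for all $k\in\mathbb{Z}$ (resp. $k\in\omega$). *)

(* Defs.v *)
From mathcomp Require Import all_boot all_order all_algebra.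
From mathcomp Require Import all_classical all_reals all_analysis.

Set Implicit Arguments.
Unset Strict Implicit.
Unset Printing Implicit Defensive.

Import Order.TTheory GRing.Theory Num.Theory.

Local Open Scope classical_set_scope.
Local Open Scope ring_scope.

(* The inverse is a field so that the iterates f^k are available for k < 0;
   it is uniquely determined by the map. *)
Record homeomorphism (X : topologicalType) := Homeomorphism {
  homeo_fun :> X -> X;
  homeo_inv : X -> X;
  homeo_funK : cancel homeo_fun homeo_inv;
  homeo_invK : cancel homeo_inv homeo_fun;
  homeo_fun_continuous : continuous homeo_fun;
  homeo_inv_continuous : continuous homeo_inv }.

(* Negz n stands for -(n + 1). *)
Definition iterz (X : topologicalType) (f : homeomorphism X) (k : int) (x : X)
    : X :=
  match k with
  | Posz n => iter n f x
  | Negz n => iter n.+1 (homeo_inv f) x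
  end.

Section Methods.
Context {R : realType} {X : metricType R}.
Implicit Types (f : X -> X) (delta : R).

Definition pseudo_orbits f delta : set (int -> X) :=
  [set u | forall k : int, mdist (f (u k)) (u (k + 1)) < delta].

Definition pos_pseudo_orbits f delta : set (nat -> X) :=
  [set u | forall k : nat, mdist (f (u k)) (u k.+1) < delta].

Definition methods f delta : set (X -> int -> X) :=
  [set phi | (forall x, pseudo_orbits f delta (phi x)) /\
             (forall x, phi x 0 = x)].

Definition pos_methods f delta : set (X -> nat -> X) :=
  [set phi | (forall x, pos_pseudo_orbits f delta (phi x)) /\
             (forall x, phi x 0%N = x)].

Definition T0_inverse_shadowing (f : homeomorphism X) : Prop :=
  forall eps : R, 0 < eps -> exists2 delta : R, 0 < delta &
    forall (x : X) (phi : X -> int -> X), methods f delta phi ->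
      exists y : X, forall k : int, mdist (phi y k) (iterz f k x) < eps.

Definition pos_T0_inverse_shadowing f : Prop :=
  forall eps : R, 0 < eps -> exists2 delta : R, 0 < delta &
    forall (x : X) (phi : X -> nat -> X), pos_methods f delta phi ->
      exists y : X, forall k : nat, mdist (phi y k) (iter k f x) < eps.

End Methods.

(* Main.v *)
Require Import Defs.
From mathcomp Require Import all_boot all_order all_algebra.
From mathcomp Require Import all_classical all_reals all_analysis.

Import Order.TTheory GRing.Theory Num.Theory.

Local Open Scope classical_set_scope.
Local Open Scope ring_scope.

(** The definition of a method constrains the pseudo-orbits [phi x]
separately for each base point [x], with no continuity relating them.  Hence
methods can be glued: if every [y] is defeated by some method [phi_y] (that is,
[phi_y y] fails to follow the given orbit), the diagonal [y |-> phi_y y] is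
again a method, and it is defeated at every [y].  Inverse shadowing forbids
this, so for each [x] some single [y] serves all methods at once, for the same
[delta].  The exchange of quantifiers, [uniform_point_diagonal], uses nothing
about methods except that diagonals of families of methods are methods, which
holds in the two-sided and in the one-sided case. *)

(** If each [y] is refuted by some function in [M], choosing one such function
for each [y] and taking the diagonal gives a function in [M] that is refuted
everywhere. *)
Lemma uniform_point_diagonal (X T : Type) (M : set (X -> T)) (S : set T) :
  (forall F : X -> X -> T, (forall y, M (F y)) -> M (fun y => F y y)) ->
  (exists y, forall phi, M phi -> S (phi y)) <->
  (forall phi, M phi -> exists y, S (phi y)).
Proof.
move=> Mdiag; split=> [[y yS] phi Mphi|shadow]; first by exists y; exact: yS.
apply: contrapT => /forallNP noy.
have refute y : exists phi : X -> T, M phi /\ ~ S (phi y).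
  by have /existsNP[phi /not_implyP[Mphi nS]] := noy y; exists phi.
have [bad badP] := choice refute.
have [y Sy] := shadow _ (Mdiag bad (fun y => (badP y).1)).
exact: (badP y).2.
Qed.

Section Diagonals.
Context {R : realType} {X : metricType R}.
Implicit Types (f : X -> X) (delta : R).

Lemma methods_diagonal f delta (F : X -> X -> int -> X) :
  (forall y, methods f delta (F y)) -> methods f delta (fun y => F y y).
Proof. by move=> MF; split=> y; have [] := MF y. Qed.

Lemma pos_methods_diagonal f delta (F : X -> X -> nat -> X) :
  (forall y, pos_methods f delta (F y)) -> pos_methods f delta (fun y => F y y).
Proof. by move=> MF; split=> y; have [] := MF y. Qed.

End Diagonals.

Theorem theorem2p1 (R : realType) (X : metricType R) :
  (forall f : homeomorphism X,
    T0_inverse_shadowing f <->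
    forall eps : R, 0 < eps -> exists2 delta : R, 0 < delta &
      forall x : X, exists y : X,
        forall phi : X -> int -> X, methods f delta phi ->
          forall k : int, mdist (iterz f k x) (phi y k) < eps)
  /\
  (forall f : X -> X, continuous f ->
    (pos_T0_inverse_shadowing f <->
    forall eps : R, 0 < eps -> exists2 delta : R, 0 < delta &
      forall x : X, exists y : X,
        forall phi : X -> nat -> X, pos_methods f delta phi ->
          forall k : nat, mdist (iter k f x) (phi y k) < eps)).
Proof.
split=> [f|f _]; split=> shadow eps /shadow[delta delta_gt0 H];
  exists delta => // x.
- apply/(uniform_point_diagonal _ _ _
    [set u | forall k, mdist (iterz f k x) (u k) < eps]
    (methods_diagonal f delta)) => phi /(H x)[y Hy].
  by exists y => k; rewrite metric_sym.
- move=> phi Mphi; have [y Hy] := H x; exists y => k.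
  by rewrite metric_sym; exact: Hy.
- apply/(uniform_point_diagonal _ _ _
    [set u | forall k, mdist (iter k f x) (u k) < eps]
    (pos_methods_diagonal f delta)) => phi /(H x)[y Hy].
  by exists y => k; rewrite metric_sym.
- move=> phi Mphi; have [y Hy] := H x; exists y => k.
  by rewrite metric_sym; exact: Hy.
Qed.
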